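(* Let $\mathsf{C}$ be a positive quasi-Markov category. Then $\mathsf{C}$ is a restriction category, with restriction structure assigning to each morphism $f\colon X\to Y$ its domain $\bar f := \mathrm{dom}(f)\colon X\to X$.
   Context: A CD category is a symmetric monoidal category $(\mathsf{C},\otimes,I)$ in which every object $X$ carries a commutative comonoid structure $\mathrm{copy}_X\colon X\to X\otimes X$, $\mathrm{del}_X\colon X\to I$, compatible with tensor products ($\mathrm{copy}_{X\otimes Y}$ is $\mathrm{copy}_X\otimes\mathrm{copy}_Y$ followed by swapping the two middle factors, and $\mathrm{del}_{X\otimes Y}=\mathrm{del}_X\otimes\mathrm{del}_Y$) and with $\mathrm{copy}_I=\mathrm{del}_I=\mathrm{id}_I$; coherence isomorphisms are suppressed. The comonoid maps are not required to be natural. A morphism $f\colon X\to Y$ is copyable if $\mathrm{copy}_Y\circ f=(f\otimes f)\circ\mathrm{copy}_X$. The domain of $f$ is $\mathrm{dom}(f):=(\mathrm{id}_X\otimes(\mathrm{del}_Y\circ f))\circ\mathrm{copy}_X\colon X\to X$. The morphism $f$ is quasi-total if $(f\otimes(\mathrm{del}_Y\circ f))\circ\mathrm{copy}_X=f$. A CD category is quasi-Markov if all its morphisms are quasi-total. A quasi-Markov category is positive if for all $u\colon X\to Y$, $v\colon Y\to Z$ such that $v\circ u$ is copyable, $(u\otimes (v\circ u))\circ\mathrm{copy}_X=(\mathrm{id}_Y\otimes v)\circ\mathrm{copy}_Y\circ u$. A restriction structure on a category is an assignment, to each morphism $f\colon X\to Y$, of an endomorphism $\bar f\colon X\to X$ such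 that: (R.1) $f\circ\bar f=f$; (R.2) $\bar f\circ\bar g=\bar g\circ\bar f$ whenever $f,g$ have the same source; (R.3) $\overline{g\circ\bar f}=\bar g\circ\bar f$ whenever $f,g$ have the same source; (R.4) $\bar g\circ f=f\circ\overline{g\circ f}$ whenever $g\circ f$ is defined. A restriction category is a category with a restriction structure. *)

(* Defs.v *)
Set Implicit Arguments.
Unset Strict Implicit.
Unset Printing Implicit Defensive.

Declare Scope cat_scope.
Delimit Scope cat_scope with cat.
Open Scope cat_scope.

Reserved Notation "g ∘ f" (at level 40, left associativity).
Reserved Notation "f ⊗ g" (at level 35, right associativity).
Reserved Notation "X ⊠ Y" (at level 35, right associativity).

Record Category := {
  ob :> Type;
  hom : ob -> ob -> Type;
  id : forall X, hom X X;
  comp : forall X Y Z, hom Y Z -> hom X Y -> hom X Z;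
  comp_assoc : forall W X Y Z (h : hom Y Z) (g : hom X Y) (f : hom W X),
    comp h (comp g f) = comp (comp h g) f;
  comp_id_l : forall X Y (f : hom X Y), comp (id Y) f = f;
  comp_id_r : forall X Y (f : hom X Y), comp f (id X) = f
}.

Arguments id {_} X.
Notation "g ∘ f" := (comp g f) : cat_scope.

(* Not assumed strict.  [X ⊠ Y] is the tensor product of objects, [f ⊗ g] that
   of morphisms.  The second hexagon follows from the first one and
   [braid_sym]. *)
Record SymMonCategory := {
  smc_cat :> Category;
  unit : smc_cat;
  tens : smc_cat -> smc_cat -> smc_cat
    where "X ⊠ Y" := (tens X Y);
  tensm : forall (X X' Y Y' : smc_cat),
    hom X X' -> hom Y Y' -> hom (X ⊠ Y) (X' ⊠ Y')
    where "f ⊗ g" := (tensm f g);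
  tensm_id : forall X Y : smc_cat, id X ⊗ id Y = id (X ⊠ Y);
  tensm_comp : forall (X X' X'' Y Y' Y'' : smc_cat)
      (f' : hom X' X'') (f : hom X X') (g' : hom Y' Y'') (g : hom Y Y'),
    (f' ∘ f) ⊗ (g' ∘ g) = (f' ⊗ g') ∘ (f ⊗ g);

  assoc : forall X Y Z : smc_cat, hom ((X ⊠ Y) ⊠ Z) (X ⊠ (Y ⊠ Z));
  assoc_inv : forall X Y Z : smc_cat, hom (X ⊠ (Y ⊠ Z)) ((X ⊠ Y) ⊠ Z);
  lunit : forall X : smc_cat, hom (unit ⊠ X) X;
  lunit_inv : forall X : smc_cat, hom X (unit ⊠ X);
  runit : forall X : smc_cat, hom (X ⊠ unit) X;
  runit_inv : forall X : smc_cat, hom X (X ⊠ unit);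
  braid : forall X Y : smc_cat, hom (X ⊠ Y) (Y ⊠ X);

  assocK : forall X Y Z, assoc_inv X Y Z ∘ assoc X Y Z = id _;
  assoc_invK : forall X Y Z, assoc X Y Z ∘ assoc_inv X Y Z = id _;
  lunitK : forall X, lunit_inv X ∘ lunit X = id _;
  lunit_invK : forall X, lunit X ∘ lunit_inv X = id _;
  runitK : forall X, runit_inv X ∘ runit X = id _;
  runit_invK : forall X, runit X ∘ runit_inv X = id _;
  braid_sym : forall X Y, braid Y X ∘ braid X Y = id _;

  assoc_nat : forall (X X' Y Y' Z Z' : smc_cat)
      (f : hom X X') (g : hom Y Y') (h : hom Z Z'),
    assoc X' Y' Z' ∘ ((f ⊗ g) ⊗ h) = (f ⊗ (g ⊗ h)) ∘ assoc X Y Z;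
  lunit_nat : forall (X Y : smc_cat) (f : hom X Y),
    lunit Y ∘ (id unit ⊗ f) = f ∘ lunit X;
  runit_nat : forall (X Y : smc_cat) (f : hom X Y),
    runit Y ∘ (f ⊗ id unit) = f ∘ runit X;
  braid_nat : forall (X X' Y Y' : smc_cat) (f : hom X X') (g : hom Y Y'),
    braid X' Y' ∘ (f ⊗ g) = (g ⊗ f) ∘ braid X Y;

  pentagon : forall W X Y Z,
    assoc W X (Y ⊠ Z) ∘ assoc (W ⊠ X) Y Z
    = (id W ⊗ assoc X Y Z) ∘ assoc W (X ⊠ Y) Z ∘ (assoc W X Y ⊗ id Z);
  triangle : forall X Y,
    (id X ⊗ lunit Y) ∘ assoc X unit Y = runit X ⊗ id Y;
  hexagon : forall X Y Z,
    assoc Y Z X ∘ braid X (Y ⊠ Z) ∘ assoc X Y Z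
    = (id Y ⊗ braid X Z) ∘ assoc Y X Z ∘ (braid X Y ⊗ id Z)
}.

Arguments unit {_}.
Arguments assoc {_} X Y Z.
Arguments assoc_inv {_} X Y Z.
Arguments lunit {_} X.
Arguments lunit_inv {_} X.
Arguments runit {_} X.
Arguments runit_inv {_} X.
Arguments braid {_} X Y.
Notation "X ⊠ Y" := (tens X Y) : cat_scope.
Notation "f ⊗ g" := (tensm f g) : cat_scope.

Definition mid_swap (C : SymMonCategory) (A B A' B' : C) :
    hom ((A ⊠ B) ⊠ (A' ⊠ B')) ((A ⊠ A') ⊠ (B ⊠ B')) :=
  assoc_inv A A' (B ⊠ B')
  ∘ (id A ⊗ (assoc A' B B' ∘ (braid B A' ⊗ id B') ∘ assoc_inv B A' B'))
  ∘ assoc A B (A' ⊠ B').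

Arguments mid_swap {_} A B A' B'.

Record CDCategory := {
  cd_smc :> SymMonCategory;
  copy : forall X : cd_smc, hom X (X ⊠ X);
  del : forall X : cd_smc, hom X unit;

  copy_coassoc : forall X,
    assoc X X X ∘ (copy X ⊗ id X) ∘ copy X = (id X ⊗ copy X) ∘ copy X;
  copy_counit_l : forall X, lunit X ∘ (del X ⊗ id X) ∘ copy X = id X;
  copy_counit_r : forall X, runit X ∘ (id X ⊗ del X) ∘ copy X = id X;
  copy_comm : forall X, braid X X ∘ copy X = copy X;

  copy_tens : forall X Y,
    copy (X ⊠ Y) = mid_swap X X Y Y ∘ (copy X ⊗ copy Y);
  del_tens : forall X Y, del (X ⊠ Y) = runit unit ∘ (del X ⊗ del Y);
  copy_unit : copy unit = runit_inv unit;
  del_unit : del unit = id unit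
}.

Arguments copy {_} X.
Arguments del {_} X.

Section CDNotions.
Variable C : CDCategory.

Definition copyable (X Y : C) (f : hom X Y) : Prop :=
  copy Y ∘ f = (f ⊗ f) ∘ copy X.

Definition dom (X Y : C) (f : hom X Y) : hom X X :=
  runit X ∘ (id X ⊗ (del Y ∘ f)) ∘ copy X.

Definition quasi_total (X Y : C) (f : hom X Y) : Prop :=
  runit Y ∘ (f ⊗ (del Y ∘ f)) ∘ copy X = f.

End CDNotions.

Definition quasi_markov (C : CDCategory) : Prop :=
  forall (X Y : C) (f : hom X Y), quasi_total f.

Definition positive (C : CDCategory) : Prop :=
  forall (X Y Z : C) (u : hom X Y) (v : hom Y Z),
    copyable (v ∘ u) ->
    (u ⊗ (v ∘ u)) ∘ copy X = (id Y ⊗ v) ∘ copy Y ∘ u.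

Record restriction_structure (C : Category)
    (bar : forall X Y : C, hom X Y -> hom X X) : Prop := {
  restr_R1 : forall (X Y : C) (f : hom X Y), f ∘ bar _ _ f = f;
  restr_R2 : forall (X Y Z : C) (f : hom X Y) (g : hom X Z),
    bar _ _ f ∘ bar _ _ g = bar _ _ g ∘ bar _ _ f;
  restr_R3 : forall (X Y Z : C) (f : hom X Y) (g : hom X Z),
    bar _ _ (g ∘ bar _ _ f) = bar _ _ g ∘ bar _ _ f;
  restr_R4 : forall (X Y Z : C) (f : hom X Y) (g : hom Y Z),
    bar _ _ g ∘ f = f ∘ bar _ _ (g ∘ f)
}.

(* Main.v *)
From Stdlib Require Import Setoid.
Require Import Defs.

Set Implicit Arguments.
Unset Strict Implicit.

(** In a CD category an effect [a : X -> I] acts on [X] by the endomorphism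
    [restrict a], which copies the input and feeds one copy to [a]; the domain
    of [f] is [restrict (del ∘ f)], so the axioms (R.1)-(R.4) are statements
    about this action.

    Two of them hold in every CD category.  Coassociativity says that
    restricting and then copying is the same as copying and then restricting
    one of the two copies ([copy_restrict]); hence
    [restrict (a ∘ restrict b) = restrict a ∘ restrict b], which is (R.3).
    Here [a ∘ restrict b] is the convolution product of the two effects, and it
    is symmetric because copying is ([effect_product_comm]); (R.2) follows.

    The other two use the hypotheses.  The equation [f ∘ dom f = f] of (R.1) is
    quasi-totality of [f], by naturality of the unitor.  For (R.4), the effect
    [del ∘ g ∘ f] is quasi-total, and for an effect this means copyable;
    positivity, applied to [f] followed by the effect [del ∘ g], is then the
    desired equation up to the unitor.

    Since the monoidal structure is not strict, one coherence fact has to be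
    derived from the pentagon and the triangle: [runit_tens]. *)

Section MonoidalLemmas.
Variable C : SymMonCategory.

Lemma tensm_comp_id_l (X Y Y' Y'' : C) (g' : hom Y' Y'') (g : hom Y Y') :
  id X ⊗ (g' ∘ g) = (id X ⊗ g') ∘ (id X ⊗ g).
Proof. rewrite <- tensm_comp, comp_id_l; reflexivity. Qed.

Lemma tensm_comp_id_r (X X' X'' Y : C) (f' : hom X' X'') (f : hom X X') :
  (f' ∘ f) ⊗ id Y = (f' ⊗ id Y) ∘ (f ⊗ id Y).
Proof. rewrite <- tensm_comp, comp_id_l; reflexivity. Qed.

Lemma tensm_factor_l (X X' Y Y' : C) (f : hom X X') (g : hom Y Y') :
  f ⊗ g = (f ⊗ id Y') ∘ (id X ⊗ g).
Proof. rewrite <- tensm_comp, comp_id_l, comp_id_r; reflexivity. Qed.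

Lemma tensm_factor_r (X X' Y Y' : C) (f : hom X X') (g : hom Y Y') :
  f ⊗ g = (id X' ⊗ g) ∘ (f ⊗ id Y).
Proof. rewrite <- tensm_comp, comp_id_l, comp_id_r; reflexivity. Qed.

Lemma runit_inv_nat (X Y : C) (f : hom X Y) :
  runit_inv Y ∘ f = (f ⊗ id unit) ∘ runit_inv X.
Proof.
  rewrite <- (comp_id_r f) at 1.
  rewrite <- runit_invK, !comp_assoc.
  rewrite <- (comp_assoc _ f), <- runit_nat, comp_assoc, runitK, comp_id_l.
  reflexivity.
Qed.

(** The right unitor is a natural isomorphism from [- ⊠ unit] to the
    identity functor. *)
Lemma tensm_unit_faithful (X Y : C) (f g : hom X Y) :
  f ⊗ id unit = g ⊗ id unit -> f = g.
Proof.
  intros E.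
  rewrite <- (comp_id_l f), <- (comp_id_l g), <- runit_invK.
  rewrite <- !comp_assoc, !runit_inv_nat, E.
  reflexivity.
Qed.

Lemma assoc_monic (W X Y Z : C) (f g : hom W ((X ⊠ Y) ⊠ Z)) :
  assoc X Y Z ∘ f = assoc X Y Z ∘ g -> f = g.
Proof.
  intros E.
  rewrite <- (comp_id_l f), <- (comp_id_l g), <- assocK.
  rewrite <- !comp_assoc, E.
  reflexivity.
Qed.

(** Kelly's argument: after tensoring with the unit object, which loses no
    information, both sides become instances of the triangle, and the pentagon
    compares them. *)
Lemma runit_tens (X Y : C) :
  runit (X ⊠ Y) = (id X ⊗ runit Y) ∘ assoc X Y unit.
Proof.
  apply tensm_unit_faithful, assoc_monic.
  rewrite tensm_comp_id_r, comp_assoc, assoc_nat.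
  rewrite <- (triangle Y unit), tensm_comp_id_l.
  rewrite <- !comp_assoc, (comp_assoc (id X ⊗ assoc Y unit unit)).
  rewrite <- pentagon.
  rewrite comp_assoc, <- assoc_nat, tensm_id, <- comp_assoc, triangle.
  reflexivity.
Qed.

End MonoidalLemmas.

Section Effects.
Variable C : CDCategory.

Definition restrict (X : C) (a : hom X unit) : hom X X :=
  runit X ∘ (id X ⊗ a) ∘ copy X.

Lemma comp_restrict (X Y : C) (f : hom X Y) (a : hom X unit) :
  f ∘ restrict a = runit Y ∘ (f ⊗ a) ∘ copy X.
Proof.
  unfold restrict.
  rewrite !comp_assoc, <- runit_nat, (tensm_factor_l f a), !comp_assoc.
  reflexivity.
Qed.

(** Coassociativity: on either side the input is copied twice and one of the
    three copies is consumed by [a]. *)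
Lemma copy_restrict (X : C) (a : hom X unit) :
  copy X ∘ restrict a = (id X ⊗ restrict a) ∘ copy X.
Proof.
  rewrite comp_restrict, runit_tens, (tensm_factor_r (copy X) a).
  rewrite <- (tensm_id X X).
  unfold restrict.
  rewrite !tensm_comp_id_l, <- !comp_assoc, <- copy_coassoc.
  rewrite !comp_assoc, <- (comp_assoc _ (assoc X X unit)), assoc_nat.
  rewrite !comp_assoc.
  reflexivity.
Qed.

Lemma restrict_comp (X : C) (a b : hom X unit) :
  restrict (a ∘ restrict b) = restrict a ∘ restrict b.
Proof.
  unfold restrict at 1 3.
  rewrite <- (comp_assoc _ (copy X)), copy_restrict, tensm_comp_id_l.
  rewrite !comp_assoc.
  reflexivity.
Qed.

(** Commutativity of copying at the unit object forces the self-braiding of the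
    unit to be trivial, because [copy unit] is invertible. *)
Lemma braid_unit : braid (@unit C) unit = id (unit ⊠ unit).
Proof.
  rewrite <- (comp_id_r (braid _ _)), <- runitK, comp_assoc.
  rewrite <- copy_unit, copy_comm.
  reflexivity.
Qed.

Lemma effect_product_comm (X : C) (a b : hom X unit) :
  a ∘ restrict b = b ∘ restrict a.
Proof.
  rewrite !comp_restrict.
  rewrite <- (copy_comm X) at 1.
  rewrite <- comp_assoc, (comp_assoc (a ⊗ b)), <- braid_nat, braid_unit.
  rewrite comp_id_l, comp_assoc.
  reflexivity.
Qed.

(** Since [del unit] is the identity and [copy unit] is the inverse of the
    unitor, the two conditions on an effect are the same equation. *)
Lemma quasi_total_effect_copyable (X : C) (a : hom X unit) :
  quasi_total a -> copyable a.
Proof.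
  unfold quasi_total, copyable.
  rewrite del_unit, comp_id_l, copy_unit.
  intros E.
  rewrite <- E at 1.
  rewrite !comp_assoc, runitK, comp_id_l.
  reflexivity.
Qed.

End Effects.

Theorem proposition1p1 (C : CDCategory)
    (C_quasi_markov : quasi_markov C) (C_positive : positive C) :
  restriction_structure (@dom C).
Proof.
  split.
  - intros X Y f.
    change (f ∘ restrict (del Y ∘ f) = f).
    rewrite comp_restrict.
    apply C_quasi_markov.
  - intros X Y Z f g.
    change (restrict (del Y ∘ f) ∘ restrict (del Z ∘ g)
            = restrict (del Z ∘ g) ∘ restrict (del Y ∘ f)).
    rewrite <- !restrict_comp, effect_product_comm.
    reflexivity.
  - intros X Y Z f g.
    change (restrict (del Z ∘ (g ∘ restrict (del Y ∘ f)))
            = restrict (del Z ∘ g) ∘ restrict (del Y ∘ f)).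
    rewrite comp_assoc.
    apply restrict_comp.
  - intros X Y Z f g.
    change (restrict (del Z ∘ g) ∘ f = f ∘ restrict (del Z ∘ (g ∘ f))).
    rewrite comp_restrict, comp_assoc.
    unfold restrict.
    rewrite <- (comp_assoc (runit Y) (f ⊗ _)), C_positive, !comp_assoc.
    + reflexivity.
    + apply quasi_total_effect_copyable, C_quasi_markov.
Qed.
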